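(* Let a combined non-degenerate finitely additive Markov chain be given on an arbitrary discrete space $(X,\Sigma_d)$, with Markov operator $A=A_{ca}+A_{pfa}$ and constants $q_1,q_2$, and suppose that $A_{ca}V_{pfa}\subset V_{pfa}$. Then for any initial finitely additive measure $\mu^1\in S_{ba}$, with $\mu^{n+1}=A\mu^n$, for any $n\in\mathbb N$, $$\|\mu^{n+1}_{ca}\|=\mu^{n+1}_{ca}(X)=q_1^{n}\cdot\mu^1_{ca}(X)=q_1^{n}\cdot\|\mu^1_{ca}\|,$$ $$\|\mu^{n+1}_{pfa}\|=\mu^{n+1}_{pfa}(X)=1-q_1^{n}\cdot\|\mu^1_{ca}\|.$$
   Context: ''Arbitrary discrete space'' $(X,\Sigma_d)$: $X$ is an infinite set, $\Sigma_d=2^X$ is the sigma-algebra of all subsets of $X$, and the cardinality of $X$ is ''immeasurable'', meaning that every finite countably additive measure on $2^X$ that is zero on every one-point set is identically zero. $B(X,\Sigma_d)$ is the space of bounded $\Sigma_d$-measurable functions $X\to\mathbb R$. $ba(X,\Sigma_d)$ and $ca(X,\Sigma_d)$ are the spaces of bounded real-valued finitely additive, respectively countably additive, measures on $\Sigma_d$, with the total variation norm. A finitely additive measure $\mu\ge0$ is purely finitely additive if every countably additive measure $\lambda$ with $0\le\lambda\le\mu$ is identically zero; a signed measure is purely finitely additive if both components of its Jordan decomposition are. $pfa(X,\Sigma_d)$ is the space of bounded purely finitely additive measures. Every $\mu\in ba(X,\Sigma_d)$ decomposes uniquely as $\mu=\mu_{ca}+\mu_{pfa}$ with $\mu_{ca}\in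 ca$, $\mu_{pfa}\in pfa$; $\mu^n_{ca}$ and $\mu^n_{pfa}$ denote the components $(\mu^n)_{ca}$ and $(\mu^n)_{pfa}$ of the measure $\mu^n$. For $\ast\in\{ba,ca,pfa\}$, $V_\ast$ is the set of nonnegative $\mu\in\ast(X,\Sigma_d)$ with $\mu(X)\le1$; $S_{ba}=\{\mu\in V_{ba}:\mu(X)=1\}$. A finitely additive Markov chain is given by a finitely additive Markov kernel: a function $P(x,E)$, $x\in X$, $E\in\Sigma_d$, with $0\le P(x,E)\le1$, $P(\cdot,E)\in B(X,\Sigma_d)$ for all $E$, $P(x,\cdot)\in ba(X,\Sigma_d)$ and $P(x,X)=1$ for all $x$. It decomposes uniquely as $P(x,E)=P_{ca}(x,E)+P_{pfa}(x,E)$ with $P_{ca}(x,\cdot)\in ca(X,\Sigma_d)$, $P_{pfa}(x,\cdot)\in pfa(X,\Sigma_d)$ for all $x$. The operators on $ba(X,\Sigma_d)$ are $A\mu(E)=\int_X P(x,E)\,\mu(dx)$, $A_{ca}\mu(E)=\int_X P_{ca}(x,E)\,\mu(dx)$, $A_{pfa}\mu(E)=\int_X P_{pfa}(x,E)\,\mu(dx)$ (Radon integrals: the sup-norm continuous extension of the integral of simple functions), so $A=A_{ca}+A_{pfa}$. The chain is called combined if there are constants $0\le q_1,q_2\le1$, $q_1+q_2=1$, with $P_{ca}(x,X)=q_1$ and $P_{pfa}(x,X)=q_2$ for all $x\in X$; it is called non-degenerate if $0<q_1,q_2<1$. $\mathbb N=\{1,2,3,\dots\}$. *)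

(* Defs.v *)
From HB Require Import structures.
From mathcomp Require Import all_boot all_order all_algebra.
From mathcomp Require Import all_classical all_reals all_analysis.

Set Implicit Arguments.
Unset Strict Implicit.
Unset Printing Implicit Defensive.

Import Order.TTheory GRing.Theory Num.Theory.
Import numFieldNormedType.Exports.

Local Open Scope classical_set_scope.
Local Open Scope ring_scope.

(* Set functions are total functions [set X -> R], suprema range over arbitrary
   subsets, and equality of set functions is Leibniz equality: the notions below
   are meant for spaces satisfying [discrete_space], where every subset is
   measurable. *)

Definition discrete_space d (X : measurableType d) : Prop :=
  forall E : set X, measurable E.

Definition immeasurable (R : realType) d (X : measurableType d) : Prop :=
  forall nu : {finite_measure set X -> \bar R},
    (forall x : X, nu [set x] = 0%E) -> forall E : set X, nu E = 0%E.

Section finitely_additive_measures.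
Context {R : realType} {d : measure_display} {X : measurableType d}.
Implicit Types (mu lambda : set X -> R) (f : X -> R) (E : set X).

Definition B_space : set (X -> R) :=
  [set f : X -> R | measurable_fun setT f /\ bounded_fun f].

Definition ba : set (set X -> R) :=
  [set mu : set X -> R | additive2 (EFin \o mu) /\ bounded_fun mu].

Definition ca : set (set X -> R) :=
  [set mu : set X -> R | ba mu /\ sigma_additive (EFin \o mu)].

Definition nonneg mu : Prop := forall E, 0 <= mu E.

Definition jordan_pos_part mu : set X -> R :=
  fun E => sup [set mu F | F in [set F | F `<=` E]].

Definition jordan_neg_part mu : set X -> R :=
  fun E => - inf [set mu F | F in [set F | F `<=` E]].

Definition purely_fa_nonneg mu : Prop :=
  forall lambda, ca lambda -> (forall E, 0 <= lambda E <= mu E) ->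
    forall E, lambda E = 0.

Definition pfa : set (set X -> R) :=
  [set mu : set X -> R | [/\ ba mu, purely_fa_nonneg (jordan_pos_part mu) &
                purely_fa_nonneg (jordan_neg_part mu)]].

Definition tv_norm mu : R :=
  sup [set s | exists n (F : nat -> set X),
    trivIset setT F /\ s = \sum_(i < n) `|mu (F i)|].

(* [(ca_part mu, pfa_part mu)] is the decomposition of [mu] in [ca + pfa], which
   exists and is unique for every [mu] in [ba]; the default value 0 is only
   there to make [ca_part] total. *)
Definition ca_part mu : set X -> R :=
  xget (fun=> 0) [set lambda : set X -> R | ca lambda /\ pfa (fun E => mu E - lambda E)].

Definition pfa_part mu : set X -> R := fun E => mu E - ca_part mu E.

Definition unit_nonneg (M : set (set X -> R)) : set (set X -> R) :=
  [set mu : set X -> R | [/\ M mu, nonneg mu & mu setT <= 1]].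

Definition V_ba := unit_nonneg ba.
Definition V_pfa := unit_nonneg pfa.

Definition S_ba : set (set X -> R) := [set mu : set X -> R | V_ba mu /\ mu setT = 1].

Definition simple_integral mu f : R :=
  \sum_(r \in range f) r * mu (f @^-1` [set r]).

(* The continuous extension of [simple_integral mu] in the uniform (sup-norm)
   topology: its limit along the simple functions converging uniformly to [f].
   On a discrete space the simple functions are those with finite range. *)
Definition radon_integral mu f : R :=
  lim (simple_integral mu @
    within [set g : X -> R | finite_set (range g)] (nbhs (f : {uniform X -> R}))).

End finitely_additive_measures.

Section markov_chains.
Context {R : realType} {d : measure_display} {X : measurableType d}.
Implicit Types (P : X -> set X -> R) (mu : set X -> R).

Definition fa_markov_kernel P : Prop :=
  [/\ forall x E, 0 <= P x E <= 1,
      forall E, B_space (fun x => P x E),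
      forall x, ba (P x) &
      forall x, P x setT = 1].

Definition kernel_ca P : X -> set X -> R := fun x => ca_part (P x).
Definition kernel_pfa P : X -> set X -> R := fun x => pfa_part (P x).

Definition kernel_op P mu : set X -> R :=
  fun E => radon_integral mu (fun x => P x E).

Definition op_A P := kernel_op P.
Definition op_ca P := kernel_op (kernel_ca P).
Definition op_pfa P := kernel_op (kernel_pfa P).

Definition combined P (q1 q2 : R) : Prop :=
  [/\ 0 <= q1 <= 1, 0 <= q2 <= 1, q1 + q2 = 1 &
      forall x, kernel_ca P x setT = q1 /\ kernel_pfa P x setT = q2].

Definition non_degenerate (q1 q2 : R) : Prop := 0 < q1 < 1 /\ 0 < q2 < 1.

End markov_chains.

(* Main.v *)
Require Import Defs.
From HB Require Import structures.
From mathcomp Require Import all_boot all_order all_algebra.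
From mathcomp Require Import all_classical all_reals all_analysis.
From mathcomp Require Import ring lra.

Set Implicit Arguments.
Unset Strict Implicit.
Unset Printing Implicit Defensive.

Import Order.TTheory GRing.Theory Num.Theory.
Import numFieldNormedType.Exports.

Local Open Scope classical_set_scope.
Local Open Scope ring_scope.

(** On a discrete space of immeasurable cardinality, countable additivity can be
    read off from one-point sets. A countably additive set function vanishing on
    all points is zero: this is immeasurability applied to the two halves of its
    Hahn-Jordan decomposition. Hence a nonnegative finitely additive measure is
    purely finitely additive exactly when it vanishes on points, and the
    countably additive component of a nonnegative [mu] is its atomic part
    [E |-> sum of mu {x} for x in E] ([ca_partE]).

    The theorem then reduces to the identity
    [(A mu)_ca (X) = q1 * mu_ca (X)] ([atomic_part_op_A]), that is, to a
    computation of the total atomic mass of [A mu]. On a point [y] the kernel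
    agrees with its countably additive part, so
    [A mu {y}] is the integral of [P_ca (x, {y})] against
    [mu = mu_ca + mu_pfa]. The hypothesis that [A_ca] preserves [V_pfa] says that
    the contribution of [mu_pfa] vanishes on points ([op_A_set1]). What is left is
    an integral against an atomic measure, which is the sum over [x] of
    [P (x, {y}) mu {x}] ([radon_integral_atomic]). Summing over [y] and exchanging
    the two sums gives [q1 * mu_ca (X)], since the atomic mass of each [P (x, .)]
    is [q1].

    The remaining claims are bookkeeping: [A] preserves nonnegativity, finite
    additivity and total mass (which requires linearity and monotonicity of the
    Radon integral), and the total variation norm of a nonnegative measure is its
    total mass. *)

(** * Simple integrals against a nonnegative finitely additive measure *)

Section finite_additivity.
Context {R : realType} {d : measure_display} {X : measurableType d}.
Implicit Types (mu nu : set X -> R) (f g : X -> R) (A B E : set X).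

Definition fa_measure mu : Prop :=
  nonneg mu /\ forall A B, A `&` B = set0 -> mu (A `|` B) = mu A + mu B.

Lemma fa_measure_set0 mu : fa_measure mu -> mu set0 = 0.
Proof.
move=> [_ addmu]; have := addmu set0 set0 (setI0 _).
by rewrite setU0 => h; apply: (addrI (mu set0)); rewrite -h addr0.
Qed.

Lemma le_fa_measure mu A B : fa_measure mu -> A `<=` B -> mu A <= mu B.
Proof.
move=> [mu_ge0 addmu] /setDUK <-.
by rewrite addmu ?setDIK// lerDl; exact: mu_ge0.
Qed.

Lemma fa_measure_preimage_seq mu (T : choiceType) (p : X -> T) (s : seq T) :
  fa_measure mu -> uniq s ->
  mu (p @^-1` [set` s]) = \sum_(t <- s) mu (p @^-1` [set t]).
Proof.
move=> mumu; elim: s => [_|t s IH /= /andP[ts us]].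
  rewrite big_nil set_nil preimage_set0; exact: fa_measure_set0.
rewrite big_cons -IH// -mumu.2.
  congr mu; apply/seteqP; split=> x /=; rewrite inE.
    by move=> /predU1P.
  by move=> xts; apply/predU1P.
by apply/seteqP; split=> // x [/= ->]; rewrite (negbTE ts).
Qed.

(** A simple integral may be computed over the fibres of any finite-valued map
    [p] through which the integrand factors: finite additivity regroups the
    fibres of [p] into those of [phi \o p]. *)
Lemma simple_integral_comp mu (T : choiceType) (p : X -> T) (phi : T -> R)
    (s : seq T) : fa_measure mu -> uniq s -> (forall x, p x \in s) ->
  simple_integral mu (phi \o p) = \sum_(t <- s) phi t * mu (p @^-1` [set t]).
Proof.
move=> mumu us ps.
have fr : finite_set (range (phi \o p)).
  apply: (@sub_finite_set _ _ [set` map phi s]) => //.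
  by move=> _ [x _ <-] /=; apply: map_f.
rewrite /simple_integral fsbig_finite//=; set D : seq R := finmap.enum_fset (fset_set _).
have inD x : phi (p x) \in D by rewrite in_fset_set//; apply/mem_set; exists x.
have fib r : mu ((phi \o p) @^-1` [set r]) =
    \sum_(t <- s) if phi t == r then mu (p @^-1` [set t]) else 0.
  rewrite -big_mkcond -big_filter -fa_measure_preimage_seq ?filter_uniq//.
  congr mu; apply/seteqP; split => x /=; rewrite mem_filter ps andbT;
    by move/eqP.
under eq_bigr do rewrite fib mulr_sumr.
rewrite exchange_big/=; apply: eq_bigr => t _.
have [tD|tD] := boolP (phi t \in D).
  rewrite (bigD1_seq (phi t) tD (finmap.fset_uniq _))/= eqxx big1 ?addr0// => r rt.
  by rewrite eq_sym (negbTE rt) mulr0.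
rewrite (_ : p @^-1` [set t] = set0); last first.
  by apply/seteqP; split => // x /= ptx; move: tD; rewrite -ptx inD.
rewrite fa_measure_set0// mulr0 big1// => r _; case: ifP; by rewrite mulr0.
Qed.

(** Two simple functions are integrated over their common refinement, the fibres
    of [x |-> (f x, g x)]; additivity and monotonicity become termwise. *)
Lemma simple_integral_pair mu f g :
  fa_measure mu -> finite_set (range f) -> finite_set (range g) ->
  exists2 s : seq (R * R), forall t, t \in s -> exists x, t = (f x, g x) &
   [/\ simple_integral mu f =
         \sum_(t <- s) t.1 * mu ((fun x => (f x, g x)) @^-1` [set t]),
       simple_integral mu g =
         \sum_(t <- s) t.2 * mu ((fun x => (f x, g x)) @^-1` [set t]),
       simple_integral mu (f \+ g) =
         \sum_(t <- s) (t.1 + t.2) * mu ((fun x => (f x, g x)) @^-1` [set t]) &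
       mu setT = \sum_(t <- s) mu ((fun x => (f x, g x)) @^-1` [set t])].
Proof.
move=> mumu ff fg; pose p x := (f x, g x).
have fp : finite_set (range p).
  apply: (@sub_finite_set _ _ (range f `*` range g)); last exact: finite_setX.
  by move=> _ [x _ <-]; split; exists x.
pose s : seq (R * R) := finmap.enum_fset (fset_set (range p)).
have us : uniq s by exact: finmap.fset_uniq.
have ps x : p x \in s by rewrite in_fset_set//; apply/mem_set; exists x.
exists s.
  by move=> t; rewrite in_fset_set// => /set_mem [x _ <-]; exists x.
split.
- exact: (simple_integral_comp fst mumu us ps).
- exact: (simple_integral_comp snd mumu us ps).
- exact: (simple_integral_comp (fun t => t.1 + t.2) mumu us ps).
- rewrite -fa_measure_preimage_seq//; congr mu.
  by apply/seteqP; split => // x _; exact: ps.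
Qed.

Lemma simple_integralD mu f g :
  fa_measure mu -> finite_set (range f) -> finite_set (range g) ->
  simple_integral mu (f \+ g) = simple_integral mu f + simple_integral mu g.
Proof.
move=> mumu ff fg; have [s _ [-> -> -> _]] := simple_integral_pair mumu ff fg.
by rewrite -big_split/=; apply: eq_bigr => t _; rewrite mulrDl.
Qed.

Lemma simple_integral_le_add mu f g (e : R) :
  fa_measure mu -> finite_set (range f) -> finite_set (range g) ->
  (forall x, f x <= g x + e) ->
  simple_integral mu f <= simple_integral mu g + e * mu setT.
Proof.
move=> mumu ff fg fge.
have [s sP [-> -> _ ->]] := simple_integral_pair mumu ff fg.
rewrite mulr_sumr -big_split/= big_seq [leRHS]big_seq.
apply: ler_sum => t /sP [x ->] /=; rewrite -mulrDl.
by apply: ler_wpM2r; [exact: mumu.1|exact: fge].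
Qed.

Lemma simple_integral_cst mu (c : R) : fa_measure mu ->
  simple_integral mu (cst c) = c * mu setT.
Proof.
move=> mumu; rewrite (@simple_integral_comp mu _ (cst tt) (cst c) [:: tt])//.
by rewrite big_seq1; congr (_ * mu _); apply/seteqP.
Qed.

Lemma simple_integral_add mu nu f : finite_set (range f) ->
  simple_integral (fun E => mu E + nu E) f =
  simple_integral mu f + simple_integral nu f.
Proof.
move=> ff; rewrite /simple_integral !fsbig_finite//= -big_split/=.
by apply: eq_bigr => r _; rewrite mulrDr.
Qed.

Definition dirac_scaled (c : R) (y : X) : set X -> R := fun E => c * \1_E y.

Lemma simple_integral_dirac (c : R) (y : X) f : finite_set (range f) ->
  simple_integral (dirac_scaled c y) f = f y * c.
Proof.
move=> ff; rewrite /simple_integral !fsbig_finite//=.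
have yf : f y \in finmap.enum_fset (fset_set (range f)).
  by rewrite in_fset_set//; apply/mem_set; exists y.
rewrite (bigD1_seq (f y) yf (finmap.fset_uniq _))/=.
rewrite /dirac_scaled indicE mem_set//= mulr1 big1 ?addr0// => r rf.
  rewrite indicE memNset ?mulr0//=; exact/nesym/eqP.
Qed.

(** * The Radon integral of a bounded function *)

Definition ubounded f := exists M, forall x, `|f x| <= M.

(** The approximant rounds [f] down to the grid of step [e] starting at the lower
    bound [- M]. *)
Lemma simple_approx f (e : R) : ubounded f -> 0 < e ->
  exists2 g, finite_set (range g) & forall x, `|f x - g x| <= e.
Proof.
move=> [M fM] e0; pose g x := e * (Num.truncn ((f x + M) / e))%:R - M.
exists g.
  pose N := (Num.truncn ((M + M) / e)).+1.
  apply: (@sub_finite_set _ _ ((fun n => e * n%:R - M) @` `I_N)); last first.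
    exact/finite_image/finite_II.
  move=> _ [x _ <-]; exists (Num.truncn ((f x + M) / e)) => //=.
  rewrite ltnS; apply: le_truncn; rewrite ler_pM2r ?invr_gt0// lerD2r.
  by rewrite (le_trans (ler_norm _)).
move=> x.
have fx0 : 0 <= (f x + M) / e.
  by rewrite divr_ge0 ?(ltW e0)//; have := fM x; rewrite ler_norml; lra.
have /andP[] := truncn_itv fx0; rewrite ler_pdivlMr// ltr_pdivrMr// -natr1.
rewrite (mulrDl _ 1) mul1r /g ler_norml.
by move=> h1 h2; apply/andP; split; lra.
Qed.

(** The quantitative form of the convergence that defines the Radon integral; the
    properties of the integral below follow from it by approximation. The limit is
    identified with the supremum of the simple integrals of the simple minorants
    of [f], which exists by completeness of [R]; the simple functions being
    uniformly dense among the bounded ones, the limit is along a proper filter. *)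
Lemma radon_integral_approx mu f g (e : R) : fa_measure mu -> ubounded f ->
  finite_set (range g) -> (forall x, `|f x - g x| <= e) ->
  `|radon_integral mu f - simple_integral mu g| <= e * mu setT.
Proof.
move=> mumu [M fM].
pose lower := [set simple_integral mu g | g in
  [set g | finite_set (range g) /\ forall x, g x <= f x]].
have fin_cst (c : R) : finite_set (range (cst c : X -> R)).
  by apply: (@sub_finite_set _ _ [set c]) => // _ [x _ <-].
have lower_le g' e' : finite_set (range g') -> (forall x, `|f x - g' x| <= e') ->
    ubound lower (simple_integral mu g' + e' * mu setT).
  move=> fg' fge' _ [h [fh hf] <-]; apply: simple_integral_le_add => // x.
  by have := fge' x; have := hf x; rewrite ler_norml; lra.
have [g0 fg0 g0f] := @simple_approx f 1 (ex_intro _ M fM) ltr01.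
have lower_ub : has_ubound lower by exists (simple_integral mu g0 + 1 * mu setT); exact: lower_le.
have lower0 : lower !=set0.
  exists (simple_integral mu (cst (- M))), (cst (- M)) => //; split => // x.
  by have := fM x; rewrite ler_norml => /andP[].
have supP g' e' : finite_set (range g') -> (forall x, `|f x - g' x| <= e') ->
    `|sup lower - simple_integral mu g'| <= e' * mu setT.
  move=> fg' fge'; rewrite ler_norml; apply/andP; split.
    rewrite lerBrDl; apply: ub_le_sup => //.
    (* lowering [g'] by [e'] makes it a minorant of [f] *)
    have fg'' : finite_set (range (g' \+ cst (- e'))).
      apply: (@sub_finite_set _ _ ((fun r => r - e') @` range g')).
        by move=> _ [x _ <-]; exists (g' x) => //; exists x.
      exact: finite_image.
    exists (g' \+ cst (- e')); last first.
      by rewrite simple_integralD// simple_integral_cst// mulNr.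
    split => // x /=; have := fge' x; rewrite ler_norml; lra.
  by rewrite lerBlDl; apply: ge_sup => //; exact: lower_le.
suff -> : radon_integral mu f = sup lower by exact: supP.
have near_f (e' : R) : 0 < e' ->
    nbhs (f : {uniform X -> R}) [set h | forall x, `|f x - h x| < e'].
  move=> e'0; apply/uniform_nbhs.
  exists [set xy : R * R | ball xy.1 e' xy.2]; split; first by rewrite -entourage_ballE; exists e'.
  by move=> h /= hf x; exact: hf.
apply: cvg_lim => //.
  apply: (@within_nbhs_proper {uniform X -> R}) => U /uniform_nbhs [E [entE EU]].
  move: entE; rewrite -entourage_ballE => -[e' /= e'0 e'E].
  have [h fh hf] := @simple_approx f (e' / 2) (ex_intro _ M fM) (divr_gt0 e'0 (ltr0Sn _ 1)).
  exists h; split => //; apply: EU => /= x _; apply: e'E => /=.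
  by rewrite /ball/= (le_lt_trans (hf x))// ltr_pdivrMr// mulr_natr mulr2n ltrDl.
apply/cvgrPdist_le => e' e'0 /=.
have mu1 : 0 < mu setT + 1 by rewrite ltr_wpDl//; exact: mumu.1.
have := near_f _ (divr_gt0 e'0 mu1).
rewrite near_withinE; apply: filterS => h hf fh.
apply: le_trans (supP h _ fh (fun x => ltW (hf x))) _.
rewrite mulrAC ler_pdivrMr// ler_wpM2l ?(ltW e'0)// lerDl//.
Qed.

(** Comparing [radon_integral_approx] with the given approximations at arbitrarily
    small scales pins down the value [I]. *)
Lemma radon_integral_unique mu f (I C : R) : fa_measure mu -> ubounded f ->
  (forall e, 0 < e -> exists g, [/\ finite_set (range g),
     forall x, `|f x - g x| <= e & `|I - simple_integral mu g| <= C * e]) ->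
  radon_integral mu f = I.
Proof.
move=> mumu bf H; apply/eqP; rewrite -subr_eq0 -normr_eq0 eq_le normr_ge0 andbT.
have C1 : 0 < `|C| + mu setT + 1.
  by rewrite ltr_wpDl// addr_ge0//; exact: mumu.1.
apply/ler_addgt0Pl => e e0; rewrite addr0.
have [g [fg fge Ige]] := H _ (divr_gt0 e0 C1).
have := radon_integral_approx mumu bf fg fge; set e' := e / _ in Ige *.
have e'0 : 0 < e' by exact: divr_gt0.
have : e = `|C| * e' + mu setT * e' + e' by rewrite /e'; field; rewrite gt_eqF.
have : C * e' <= `|C| * e' by rewrite ler_wpM2r ?(ltW e'0) ?ler_norm.
move: Ige; rewrite [_ * mu setT]mulrC !ler_norml; lra.
Qed.

Lemma ubounded_add f g : ubounded f -> ubounded g -> ubounded (f \+ g).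
Proof.
move=> [M fM] [N gN]; exists (M + N) => x.
by apply: le_trans (ler_normD _ _) _; rewrite lerD.
Qed.

Lemma radon_integralD mu f g : fa_measure mu -> ubounded f -> ubounded g ->
  radon_integral mu (f \+ g) = radon_integral mu f + radon_integral mu g.
Proof.
move=> mumu bf bg.
apply: (@radon_integral_unique _ _ _ (mu setT)) => //; first exact: ubounded_add.
move=> e e0; have e20 : 0 < e / 2 by exact: divr_gt0.
have [f' ff' f'f] := simple_approx bf e20.
have [g' fg' g'g] := simple_approx bg e20.
exists (f' \+ g'); split.
- apply: (@sub_finite_set _ _ ((fun t => t.1 + t.2) @` (range f' `*` range g'))).
    by move=> _ [x _ <-]; exists (f' x, g' x) => //; split; exists x.
  exact/finite_image/finite_setX.
- by move=> x /=; have := f'f x; have := g'g x; rewrite !ler_norml; lra.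
- rewrite simple_integralD//.
  have := radon_integral_approx mumu bf ff' f'f.
  have := radon_integral_approx mumu bg fg' g'g.
  rewrite !ler_norml; lra.
Qed.

Lemma fa_measureD mu nu : fa_measure mu -> fa_measure nu ->
  fa_measure (fun E => mu E + nu E).
Proof.
move=> mumu nunu; split=> [E|A B AB]; first by rewrite addr_ge0 ?mumu.1 ?nunu.1.
by rewrite mumu.2// nunu.2// addrACA.
Qed.

Lemma radon_integral_add mu nu f : fa_measure mu -> fa_measure nu ->
  ubounded f ->
  radon_integral (fun E => mu E + nu E) f =
  radon_integral mu f + radon_integral nu f.
Proof.
move=> mumu nunu bf.
apply: (@radon_integral_unique _ _ _ (mu setT + nu setT)) => //.
  exact: fa_measureD.
move=> e e0; have [g fg gf] := simple_approx bf e0; exists g; split => //.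
rewrite simple_integral_add//.
have := radon_integral_approx mumu bf fg gf.
have := radon_integral_approx nunu bf fg gf.
rewrite !ler_norml; lra.
Qed.

Lemma radon_integral_le mu f g : fa_measure mu -> ubounded f -> ubounded g ->
  (forall x, f x <= g x) -> radon_integral mu f <= radon_integral mu g.
Proof.
move=> mumu bf bg fg; apply/ler_addgt0Pr => e e0.
have mu1 : 0 < mu setT + 1 by rewrite ltr_wpDl//; exact: mumu.1.
(* the total error is at most [4 * e' * mu setT]: [e'] for each of the two
   integrals and [2 * e'] for comparing the approximants *)
set e' := e / (4 * (mu setT + 1)).
have e'0 : 0 < e' by rewrite divr_gt0// mulr_gt0.
have [f' ff' f'f] := simple_approx bf e'0.
have [g' fg' g'g] := simple_approx bg e'0.
have le_fg' : simple_integral mu f' <= simple_integral mu g' + (2 * e') * mu setT.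
  apply: simple_integral_le_add => // x; have := f'f x; have := g'g x; have := fg x.
  rewrite !ler_norml; lra.
have := radon_integral_approx mumu bf ff' f'f.
have := radon_integral_approx mumu bg fg' g'g.
have : e = 4 * (e' * mu setT) + 4 * e'.
  by rewrite /e'; field; rewrite gt_eqF.
move: le_fg'; rewrite -mulrA !ler_norml; lra.
Qed.

Lemma radon_integral_cst mu (c : R) : fa_measure mu ->
  radon_integral mu (cst c) = c * mu setT.
Proof.
move=> mumu; apply: (@radon_integral_unique _ _ _ 0) => //.
  by exists `|c| => x.
move=> e e0; exists (cst c); split.
- by apply: (@sub_finite_set _ _ [set c]) => // _ [x _ <-].
- by move=> x; rewrite subrr normr0 ltW.
- by rewrite simple_integral_cst// subrr normr0 mul0r.
Qed.

Lemma fa_measure_dirac (c : R) (y : X) : 0 <= c -> fa_measure (dirac_scaled c y).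
Proof.
move=> c0; split => [E|A B AB]; first by rewrite mulr_ge0.
rewrite /dirac_scaled !indicE -mulrDr in_setU -natrD; congr (_ * _%:R).
have : ~ (y \in A /\ y \in B) by rewrite !inE => yAB; have : (A `&` B) y by []; rewrite AB.
by case: (y \in A); case: (y \in B) => // /(_ (conj isT isT)).
Qed.

Lemma radon_integral_dirac (c : R) (y : X) f : 0 <= c -> ubounded f ->
  radon_integral (dirac_scaled c y) f = f y * c.
Proof.
move=> c0 bf; apply: (@radon_integral_unique _ _ _ c) => //.
  exact: fa_measure_dirac.
move=> e e0; have [g fg gf] := simple_approx bf e0; exists g; split => //.
rewrite simple_integral_dirac// -mulrBl normrM (ger0_norm c0) mulrC.
by rewrite ler_wpM2l.
Qed.

End finite_additivity.

(** * The atomic part of a finitely additive measure *)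

Section atomic_part.
Context {R : realType} {d : measure_display} {X : measurableType d}.
Implicit Types (mu nu : set X -> R) (f g : X -> R) (A B E : set X).

Definition point_mass mu E : \bar R := \esum_(x in E) (mu [set x])%:E.

Definition atomic_part mu E : R := fine (point_mass mu E).

Lemma fa_measure_seq mu (s : seq X) : fa_measure mu -> uniq s ->
  mu [set` s] = \sum_(x <- s) mu [set x].
Proof. exact: (@fa_measure_preimage_seq _ _ _ mu X id). Qed.

Lemma finite_uniq_seq (T : choiceType) (E : set T) :
  finite_set E -> exists2 s : seq T, uniq s & E = [set` s].
Proof.
move=> /finite_seqP[s ->]; exists (undup s); first exact: undup_uniq.
by apply/seteqP; split => x /=; rewrite mem_undup.
Qed.

Lemma fsum_point_mass mu E : fa_measure mu -> finite_set E ->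
  (\sum_(x \in E) (mu [set x])%:E)%E = (mu E)%:E.
Proof.
move=> mumu /finite_uniq_seq[s us ->].
by rewrite -fsbig_seq// sumEFin fa_measure_seq.
Qed.

(** A finite sum of point masses is the measure of a finite set, hence at most the
    measure of the whole set; in particular the sum of all of them converges. *)
Lemma point_mass_le mu E : fa_measure mu -> (point_mass mu E <= (mu E)%:E)%E.
Proof.
move=> mumu; apply: ge_ereal_sup => _ [F [fF FE] <-].
by rewrite fsum_point_mass// lee_fin; exact: le_fa_measure.
Qed.

Lemma point_mass_ge0 mu E : fa_measure mu -> (0 <= point_mass mu E)%E.
Proof. by move=> mumu; apply: esum_ge0 => x _; rewrite lee_fin; exact: mumu.1. Qed.

Lemma EFin_atomic_part mu E : fa_measure mu ->
  (atomic_part mu E)%:E = point_mass mu E.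
Proof.
move=> mumu; rewrite fineK// ge0_fin_numE ?point_mass_ge0//.
exact: le_lt_trans (point_mass_le _ mumu) (ltry _).
Qed.

Lemma atomic_part_le mu E : fa_measure mu -> atomic_part mu E <= mu E.
Proof. by move=> mumu; rewrite -lee_fin EFin_atomic_part//; exact: point_mass_le. Qed.

Lemma atomic_part_set1 mu x : fa_measure mu ->
  atomic_part mu [set x] = mu [set x].
Proof.
by move=> mumu; rewrite /atomic_part /point_mass esum_set1// lee_fin; exact: mumu.1.
Qed.

Lemma point_mass_atomic_part mu E : fa_measure mu ->
  point_mass (atomic_part mu) E = point_mass mu E.
Proof. by move=> mumu; apply: eq_esum => x _; rewrite atomic_part_set1. Qed.

Lemma fa_measure_atomic_part mu : fa_measure mu -> fa_measure (atomic_part mu).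
Proof.
move=> mumu; split => [E|A B AB].
  by rewrite -lee_fin EFin_atomic_part//; exact: point_mass_ge0.
apply: EFin_inj; rewrite EFinD !EFin_atomic_part// /point_mass (esumID A); last first.
  by move=> x _; rewrite lee_fin; exact: mumu.1.
have AB' : B `<=` ~` A by move=> x Bx Ax; have : (A `&` B) x by []; rewrite AB.
rewrite !setIUl setIid setICr set0U (setIidl AB').
by rewrite [B `&` A]setIC AB setU0.
Qed.

Lemma ba_fa_measure mu : fa_measure mu -> ba mu.
Proof.
move=> mumu; split => [A B _ _ AB|]; first by rewrite /= mumu.2.
exists (mu setT); split => [|N muN A _ /=]; first exact: num_real.
by rewrite ger0_norm ?(le_trans _ (ltW muN)) ?le_fa_measure//; exact: mumu.1.
Qed.

(** Countable additivity is associativity of unordered sums of nonnegative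
    terms. *)
Lemma ca_atomic_part mu : fa_measure mu -> ca (atomic_part mu).
Proof.
move=> mumu; split; first exact/ba_fa_measure/fa_measure_atomic_part.
move=> F _ tF /=; rewrite EFin_atomic_part// /point_mass esum_bigcupT//; last first.
  by move=> x; rewrite lee_fin; exact: mumu.1.
under eq_fun do under eq_bigr do rewrite EFin_atomic_part//.
rewrite -nneseries_esumT; last by move=> n; exact: point_mass_ge0.
by apply: is_cvg_nneseries => n _ _; exact: point_mass_ge0.
Qed.

Lemma sum_fa_measure_le mu (F : nat -> set X) n : fa_measure mu ->
  trivIset setT F -> \sum_(i < n) mu (F i) <= mu setT.
Proof.
move=> mumu tF.
have -> : \sum_(i < n) mu (F i) = mu (\big[setU/set0]_(i < n) F i).
  elim: n => [|n IH]; first by rewrite !big_ord0 fa_measure_set0.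
  rewrite !big_ord_recr/= mumu.2 ?IH//.
  by apply: (@trivIset_bigsetUI _ predT) => // i j _ _; exact: tF.
exact: le_fa_measure.
Qed.

Lemma tv_norm_fa_measure mu : fa_measure mu -> tv_norm mu = mu setT.
Proof.
move=> mumu.
have tv_ub : ubound [set s | exists n (F : nat -> set X),
    trivIset setT F /\ s = \sum_(i < n) `|mu (F i)|] (mu setT).
  move=> _ [n [F [tF ->]]]; apply: le_trans (sum_fa_measure_le n mumu tF).
  by apply: ler_sum => i _; rewrite ger0_norm//; exact: mumu.1.
apply/eqP; rewrite eq_le; apply/andP; split.
  apply: ge_sup => //; exists 0, 0%N, (fun=> set0); split; last by rewrite big_ord0.
  exact: trivIset_set0.
apply: ub_le_sup; first by exists (mu setT).
exists 1%N, (fun n => if n is 0%N then setT else set0); split.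
  by apply/trivIsetP => -[|i] [|j] //= _ _; rewrite ?setI0 ?set0I.
by rewrite big_ord1/= ger0_norm//; exact: mumu.1.
Qed.

(** * Integration against an atomic measure *)

Lemma fa_measure_setD nu A : fa_measure nu -> fa_measure (fun E => nu (E `\` A)).
Proof.
move=> nunu; split => [E|B C BC]; first exact: nunu.1.
rewrite setDUl nunu.2//; apply/seteqP; split => // x [[Bx _] [Cx _]].
by rewrite -BC.
Qed.

(** The points of a finite set are split off one at a time, as scaled Dirac masses,
    on which integration is evaluation. *)
Lemma radon_integral_split nu f (s : seq X) : fa_measure nu -> ubounded f ->
  uniq s -> radon_integral nu f =
    \sum_(x <- s) f x * nu [set x] +
    radon_integral (fun E => nu (E `\` [set` s])) f.
Proof.
move=> + bf; elim: s nu => [|y s IH] nu nunu us.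
  rewrite big_nil add0r; congr (radon_integral _ f).
  by apply/funext => E; rewrite set_nil setD0.
move: us => /= /andP[ys us].
have nuE : nu = fun E => dirac_scaled (nu [set y]) y E + nu (E `\` [set y]).
  apply/funext => E; rewrite /dirac_scaled indicE.
  have [yE|yE] := boolP (y \in E).
    rewrite mulr1 -nunu.2 ?setDIK// setDUK// => _ ->; exact: set_mem.
  rewrite mulr0 add0r; congr nu; apply/esym/setDidl.
  by apply/seteqP; split => // x [Ex xy]; move: yE; rewrite -xy mem_set.
have nuy := fa_measure_setD [set y] nunu.
rewrite [in LHS]nuE radon_integral_add//; last first.
  by apply: fa_measure_dirac; exact: nunu.1.
rewrite radon_integral_dirac//; last exact: nunu.1.
rewrite (IH _ nuy us) big_cons addrA; congr (_ + _ + _).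
  apply: eq_big_seq => x xs; congr (_ * nu _).
  apply/setDidl/seteqP; split => // z [/= -> xy]; by move: ys; rewrite -xy xs.
congr (radon_integral _ f); apply/funext => E; rewrite setDDl; congr (nu (_ `\` _)).
apply/seteqP; split => x /=; rewrite inE.
  by move=> [xs|->]; rewrite ?eqxx ?xs ?orbT.
by move=> /predU1P[->|xs]; [right|left].
Qed.

(** Split off a finite set [F] of points: the integral over the complement of [F]
    is nonnegative and at most [`|M| * nu (~ F)], and [nu (~ F)] is as small as
    desired because [nu] is the sum of its point masses. *)
Lemma radon_integral_atomic nu f : fa_measure nu ->
  (nu setT)%:E = point_mass nu setT ->
  ubounded f -> (forall x, 0 <= f x) ->
  (radon_integral nu f)%:E = \esum_(x in setT) (f x * nu [set x])%:E.
Proof.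
move=> nunu nuT /[dup] bf [M fM] f0.
have fnu0 x : (0 <= (f x * nu [set x])%:E)%E.
  by rewrite lee_fin mulr_ge0//; exact: nunu.1.
have b0 c : ubounded (cst c : X -> R) by exists `|c|.
apply/eqP; rewrite eq_le; apply/andP; split; last first.
  apply: ge_ereal_sup => _ [F [/finite_uniq_seq[s us ->] _] <-].
  rewrite -fsbig_seq// sumEFin lee_fin (radon_integral_split nunu bf us) lerDl.
  rewrite -[leLHS](mul0r (nu (setT `\` [set` s]))).
  rewrite -(radon_integral_cst 0 (fa_measure_setD _ nunu)).
  by apply: radon_integral_le => //; exact: fa_measure_setD.
apply/lee_addgt0Pr => e e0.
have M1 : 0 < `|M| + 1 by rewrite ltr_wpDl.
have e'0 : 0 < e / (`|M| + 1) by exact: divr_gt0.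
have nufin : point_mass nu setT \is a fin_num by rewrite -nuT.
have [_ [F [fF _] <-]] := ub_ereal_sup_adherent e'0 nufin.
rewrite fsum_point_mass//; rewrite -[ereal_sup _]/(point_mass nu setT) -nuT.
rewrite -EFinB lte_fin ltrBlDl => nuF.
have [s us Fs] := finite_uniq_seq fF.
rewrite (radon_integral_split nunu bf us) EFinD.
apply: leeD.
  apply: ereal_sup_ubound; exists F; first by split.
  by rewrite Fs -fsbig_seq// sumEFin.
rewrite -Fs lee_fin; have nuD := fa_measure_setD F nunu.
have : radon_integral (fun E => nu (E `\` F)) f <= `|M| * nu (setT `\` F).
  rewrite -(radon_integral_cst `|M| nuD); apply: radon_integral_le => // x.
  by rewrite (le_trans (ler_norm _))// (le_trans (fM x))// ler_norm.
move=> /le_trans; apply.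
have : nu setT = nu F + nu (setT `\` F) by rewrite -nunu.2 ?setDIK// setDUK.
move: nuF => + nuTE; rewrite nuTE addrC ltrD2r => /ltW.
rewrite ler_pdivlMr//; have := nunu.1 (setT `\` F).
rewrite mulrDr mulr1 mulrC; lra.
Qed.

End atomic_part.

(** * The countably additive component is the atomic part *)

Section yosida_hewitt.
Context {R : realType} {d : measure_display} {X : measurableType d}.
Implicit Types (mu nu : set X -> R) (f g : X -> R) (A B E : set X).

Lemma ca_dirac_scaled (c : R) (y : X) : 0 <= c -> ca (dirac_scaled c y).
Proof.
move=> c0; split; first exact/ba_fa_measure/fa_measure_dirac.
move=> F mF tF; have -> : EFin \o dirac_scaled c y = mscale (NngNum c0) \d_y.
  by apply/funext => E; rewrite /= /mscale/= diracE /dirac_scaled indicE EFinM.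
exact: measure_sigma_additive.
Qed.

Lemma jordan_pos_part_ge mu E F : ba mu -> F `<=` E -> mu F <= jordan_pos_part mu E.
Proof.
move=> [_ bmu] FE; apply: ub_le_sup; last by exists F.
have [M [_ Mmu]] := bmu; exists (M + 1) => _ [G _ <-].
by apply: le_trans (ler_norm _) _; apply: Mmu => //; rewrite ltrDl.
Qed.

Lemma ba_set0 mu : ba mu -> mu set0 = 0.
Proof.
move=> [amu _]; have := amu set0 set0 measurable0 measurable0 (setI0 _).
by rewrite setU0 /= -EFinD => -[] h; apply: (addrI (mu set0)); rewrite -h addr0.
Qed.

Lemma jordan_neg_partE mu : jordan_neg_part mu = jordan_pos_part (fun E => - mu E).
Proof.
apply/funext => E; rewrite /jordan_neg_part /jordan_pos_part /inf opprK.
by congr sup; rewrite image_comp.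
Qed.

Lemma ba_opp mu : ba mu -> ba (fun E => - mu E).
Proof.
move=> [amu [M [Mr Mmu]]]; split.
  move=> A B mA mB AB /=; have /= := amu A B mA mB AB.
  by rewrite -!EFinD => -[->]; rewrite opprD.
by exists M; split => // N MN E _ /=; rewrite normrN; exact: Mmu.
Qed.

Lemma jordan_pos_part_set1_ge0 mu x : ba mu -> 0 <= jordan_pos_part mu [set x].
Proof. by move=> bmu; rewrite -(ba_set0 bmu); apply: jordan_pos_part_ge. Qed.

Lemma jordan_pos_part_mono mu E F : ba mu -> F `<=` E ->
  jordan_pos_part mu F <= jordan_pos_part mu E.
Proof.
move=> bmu FE; apply: ge_sup; first by exists (mu set0), set0.
move=> _ [G GF <-]; apply: jordan_pos_part_ge => //; exact: subset_trans FE.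
Qed.

(** If the positive part charges the point [x] with mass [c], then it dominates the
    countably additive measure [c] times the Dirac mass at [x], so [c = 0]. *)
Lemma purely_fa_set1_le0 mu x : ba mu -> purely_fa_nonneg (jordan_pos_part mu) ->
  mu [set x] <= 0.
Proof.
move=> bmu pmu; have c0 := jordan_pos_part_set1_ge0 x bmu.
suff <- : jordan_pos_part mu [set x] = 0 by exact: jordan_pos_part_ge.
have := pmu _ (ca_dirac_scaled x c0) _ [set x].
rewrite /dirac_scaled indicE mem_set//= mulr1; apply => E.
rewrite mulr_ge0//=; have [xE|xE] := boolP (x \in E); rewrite indicE.
  rewrite xE mulr1; apply: jordan_pos_part_mono => // _ ->; exact: set_mem.
by rewrite (negbTE xE) mulr0 -(ba_set0 bmu); exact: jordan_pos_part_ge.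
Qed.

Lemma pfa_set1 mu x : pfa mu -> mu [set x] = 0.
Proof.
move=> [bmu pmu nmu]; apply/eqP; rewrite eq_le purely_fa_set1_le0//=.
rewrite -oppr_le0; apply: (@purely_fa_set1_le0 (fun E => - mu E)).
  exact: ba_opp.
by rewrite -jordan_neg_partE.
Qed.

Context (X_discrete : discrete_space X) (X_immeasurable : immeasurable R X).

(** Immeasurability concerns measures; it reaches signed set functions through the
    Hahn decomposition, whose two halves also vanish on points. *)
Lemma sigma_additive_eq0 mu : mu set0 = 0 -> sigma_additive (EFin \o mu) ->
  (forall x, mu [set x] = 0) -> forall E, mu E = 0.
Proof.
move=> mu0 smu mux E.
pose m := isCharge.Build d X R (EFin \o mu) (congr1 EFin mu0)
  (fun _ _ => isT) (fun F mF tF _ => smu F mF tF).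
pose nu : {charge set X -> \bar R} := HB.pack (EFin \o mu) m.
have [P [N PN]] := Hahn_decomposition nu.
have nu_set1 x A : nu ([set x] `&` A) = 0%E.
  have [xA|xA] := pselect (A x).
    by rewrite setIidl ?/nu/= ?mux// => _ ->.
  rewrite (_ : _ `&` _ = set0) ?charge0//.
  by apply/seteqP; split => // y [/= ->].
have pos0 : jordan_pos PN E = 0%E.
  apply: X_immeasurable => x /=.
  rewrite jordan_posE cjordan_posE /crestr0 mem_set; last exact: X_discrete.
  exact: nu_set1.
have neg0 : jordan_neg PN E = 0%E.
  apply: X_immeasurable => x /=; rewrite jordan_negE cjordan_negE.
  rewrite /crestr0 mem_set; last exact: X_discrete.
  by rewrite [X in (- X)%E]nu_set1 oppe0.
have : (mu E)%:E = (jordan_pos PN E + (-1)%:E * jordan_neg PN E)%E.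
  exact: (jordan_decomp PN (X_discrete E)).
by rewrite pos0 neg0 mule0 adde0 => -[].
Qed.

Lemma fa_measure_ba mu : ba mu -> nonneg mu -> fa_measure mu.
Proof.
by move=> [amu _] mu0; split => // A B AB; have [] := amu A B (X_discrete A) (X_discrete B) AB.
Qed.

(** The converse of [pfa_set1] for nonnegative measures: a countably additive
    minorant vanishes on points too, hence is zero. *)
Lemma pfa_fa_measure mu : fa_measure mu -> (forall x, mu [set x] = 0) -> pfa mu.
Proof.
move=> mumu mux; have bmu := ba_fa_measure mumu; split => // lambda.
  move=> [blam slam] lam; apply: sigma_additive_eq0 => //; first exact: ba_set0.
  move=> x; apply/eqP; rewrite eq_le; have /andP[-> +] := lam [set x].
  move=> /le_trans -> //; apply: ge_sup; first by exists (mu set0), set0.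
  by move=> _ [F Fx <-]; rewrite -(mux x); exact: le_fa_measure.
move=> _ lam E; apply/eqP; rewrite eq_le; have /andP[-> +] := lam E.
move=> /le_trans -> //; rewrite jordan_neg_partE; apply: ge_sup.
  by exists (- mu set0), set0.
by move=> _ [F FE <-]; rewrite oppr_le0; exact: mumu.1.
Qed.

Lemma fa_measure_sub_atomic mu : fa_measure mu ->
  fa_measure (fun E => mu E - atomic_part mu E).
Proof.
move=> mumu; split => [E|A B AB]; first by rewrite subr_ge0 atomic_part_le.
by rewrite mumu.2// (fa_measure_atomic_part mumu).2// opprD addrACA.
Qed.

Lemma pfa_sub_atomic mu : fa_measure mu -> pfa (fun E => mu E - atomic_part mu E).
Proof.
move=> mumu; apply: pfa_fa_measure; first exact: fa_measure_sub_atomic.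
by move=> x; rewrite atomic_part_set1// subrr.
Qed.

(** The two countably additive candidates agree on points, because purely finitely
    additive measures vanish there; their difference is then zero. *)
Lemma ca_partE mu : fa_measure mu -> ca_part mu = atomic_part mu.
Proof.
move=> mumu; apply: xget_unique.
  by split; [exact: ca_atomic_part|exact: pfa_sub_atomic].
move=> lambda [[blam slam] plam].
have [batm satm] := ca_atomic_part mumu.
suff H E : lambda E - atomic_part mu E = 0.
  by apply/funext => E; apply/eqP; rewrite -subr_eq0 H.
apply: (@sigma_additive_eq0 (fun E => lambda E - atomic_part mu E)).
- by rewrite ba_set0// ba_set0// subrr.
- move=> F mF tF /=; rewrite EFinB.
  under eq_fun do under eq_bigr do rewrite EFinB.
  have -> : (fun n => \sum_(0 <= i < n) ((lambda (F i))%:E - (atomic_part mu (F i))%:E))%E =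
     (fun n => \sum_(0 <= i < n) (lambda (F i))%:E - \sum_(0 <= i < n) (atomic_part mu (F i))%:E)%E.
    by apply/funext => n; rewrite !sumEFin -EFinB -sumrB -sumEFin.
  by apply: cvgeB => //; [exact: slam|exact: satm].
- move=> x; have := pfa_set1 x plam.
  by rewrite atomic_part_set1// => /eqP; rewrite subr_eq0 => /eqP ->; rewrite subrr.
Qed.

End yosida_hewitt.

(** * Atomic mass under a combined Markov chain *)

Section markov.
Context {R : realType} {d : measure_display} {X : measurableType d}.
Context (X_discrete : discrete_space X) (X_immeasurable : immeasurable R X).
Context (P : X -> set X -> R) (q1 q2 : R) (P_kernel : fa_markov_kernel P).
Implicit Types (mu nu : set X -> R).

Lemma fa_measure_kernel x : fa_measure (P x).
Proof.
have [P01 _ bP _] := P_kernel; apply: fa_measure_ba => // E.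
by have /andP[] := P01 x E.
Qed.

Lemma kernel_ubounded E : ubounded (P ^~ E).
Proof.
exists 1 => x; have [P01 _ _ _] := P_kernel.
by have /andP[P0 P1] := P01 x E; rewrite ger0_norm.
Qed.

Lemma fa_measure_op_A mu : fa_measure mu -> fa_measure (op_A P mu).
Proof.
move=> mumu; split => [E|A B AB].
  rewrite -(mul0r (mu setT)) -(radon_integral_cst 0 mumu).
  apply: radon_integral_le => //; [by exists 0 => x; rewrite normr0|exact: kernel_ubounded|].
  by move=> x; exact: (fa_measure_kernel x).1.
rewrite /op_A /kernel_op -radon_integralD//; [|exact: kernel_ubounded..].
by congr radon_integral; apply/funext => x; rewrite (fa_measure_kernel x).2.
Qed.

Lemma op_A_setT mu : fa_measure mu -> op_A P mu setT = mu setT.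
Proof.
move=> mumu; rewrite -[RHS]mul1r -radon_integral_cst//; congr radon_integral.
by apply/funext => x; have [_ _ _ ->] := P_kernel.
Qed.

Context (P_combined : combined P q1 q2).
Context (A_ca_V_pfa : op_ca P @` V_pfa `<=` V_pfa).

Lemma kernel_caE x : kernel_ca P x = atomic_part (P x).
Proof. exact/ca_partE/fa_measure_kernel. Qed.

Lemma point_mass_kernel x : point_mass (P x) setT = q1%:E.
Proof.
rewrite -EFin_atomic_part; last exact: fa_measure_kernel.
by rewrite -kernel_caE; have [_ _ _ /(_ x)[->]] := P_combined.
Qed.

(** Points do not see the purely finitely additive part of [mu]. Its contribution
    to [A mu {y}] only involves [P (x, {y}) = P_ca (x, {y})], so it equals
    [A_ca mu_pfa {y}], which is zero as [A_ca mu_pfa] is purely finitely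
    additive. *)
Lemma op_A_set1 mu y : fa_measure mu -> mu setT <= 1 ->
  op_A P mu [set y] = radon_integral (atomic_part mu) (P ^~ [set y]).
Proof.
move=> mumu mu1.
have muE : mu = fun E => atomic_part mu E + (mu E - atomic_part mu E).
  by apply/funext => E; rewrite subrKC.
rewrite /op_A /kernel_op [in LHS]muE.
have fatm := fa_measure_atomic_part mumu.
have fsub := fa_measure_sub_atomic mumu.
rewrite radon_integral_add//; last exact: kernel_ubounded.
suff -> : radon_integral (fun E => mu E - atomic_part mu E) (P ^~ [set y]) = 0.
  by rewrite addr0.
have [pA _ _] : V_pfa (op_ca P (fun E => mu E - atomic_part mu E)).
  apply: A_ca_V_pfa; exists (fun E => mu E - atomic_part mu E) => //; split.
  - exact: pfa_sub_atomic.
  - exact: fsub.1.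
  - by rewrite lerBlDr (le_trans mu1)// lerDl; exact: fatm.1.
rewrite -[RHS](pfa_set1 y pA); congr radon_integral; apply/funext => x.
by rewrite kernel_caE atomic_part_set1//; exact: fa_measure_kernel.
Qed.

(** The sum on the left is the integral of the constant [c] against the atomic part
    of [mu]. *)
Lemma esum_scale mu (c : R) : fa_measure mu -> 0 <= c ->
  \esum_(x in setT) (c * mu [set x])%:E = (c%:E * point_mass mu setT)%E.
Proof.
move=> mumu c0; have fatm := fa_measure_atomic_part mumu.
rewrite -EFin_atomic_part// -EFinM -radon_integral_cst//.
rewrite radon_integral_atomic//; last by exists `|c|.
  by apply: eq_esum => x _; rewrite atomic_part_set1.
by rewrite EFin_atomic_part// point_mass_atomic_part.
Qed.

(** Tonelli: the double sum of [P (x, {y}) mu {x}] is the atomic mass of [A mu]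
    when [x] is summed first, and [q1] times the atomic mass of [mu] when [y] is. *)
Lemma atomic_part_op_A mu : fa_measure mu -> mu setT <= 1 ->
  atomic_part (op_A P mu) setT = q1 * atomic_part mu setT.
Proof.
move=> mumu mu1; have fA := fa_measure_op_A mumu.
have q10 : 0 <= q1 by have [/andP[]] := P_combined.
have fatm := fa_measure_atomic_part mumu.
apply: EFin_inj; rewrite EFin_atomic_part// EFinM EFin_atomic_part// -esum_scale//.
transitivity (\esum_(y in setT) \esum_(x in setT) (P x [set y] * mu [set x])%:E).
  apply: eq_esum => y _; rewrite op_A_set1// radon_integral_atomic//.
  - by apply: eq_esum => x _; rewrite atomic_part_set1.
  - by rewrite EFin_atomic_part// point_mass_atomic_part.
  - exact: kernel_ubounded.
  - by move=> x; exact: (fa_measure_kernel x).1.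
have K0 x y : (0 <= (P x [set y] * mu [set x])%:E)%E.
  by rewrite lee_fin mulr_ge0 ?(fa_measure_kernel x).1 ?mumu.1.
rewrite esum_esum//.
transitivity (\esum_(x in setT) \esum_(y in setT) (P x [set y] * mu [set x])%:E).
  rewrite esum_esum//; apply: (reindex_esum _ _ (fun k => (k.2, k.1))).
  by split => [[]|[a b] [a' b'] _ _ [-> ->]|[a b] _] //; exists (b, a).
apply: eq_esum => x _; under eq_esum do rewrite mulrC.
rewrite esum_scale; [|exact: fa_measure_kernel|exact: mumu.1].
by rewrite point_mass_kernel -EFinM mulrC.
Qed.

End markov.

Theorem theorem5p2 (R : realType) (d : measure_display) (X : measurableType d)
    (X_infinite : infinite_set [set: X])
    (X_discrete : discrete_space X)
    (X_immeasurable : immeasurable R X)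
    (P : X -> set X -> R) (q1 q2 : R)
    (P_kernel : fa_markov_kernel P)
    (P_combined : combined P q1 q2)
    (q_non_degenerate : non_degenerate q1 q2)
    (A_ca_V_pfa : op_ca P @` V_pfa `<=` V_pfa)
    (mu : nat -> set X -> R)
    (mu_init : S_ba (mu 1%N))
    (mu_step : forall n : nat, (1 <= n)%N -> mu n.+1 = op_A P (mu n))
    (n : nat) (n_ge1 : (1 <= n)%N) :
  [/\ tv_norm (ca_part (mu n.+1)) = ca_part (mu n.+1) setT,
      ca_part (mu n.+1) setT = q1 ^+ n * ca_part (mu 1%N) setT &
      q1 ^+ n * ca_part (mu 1%N) setT =
        q1 ^+ n * tv_norm (ca_part (mu 1%N))] /\
  tv_norm (pfa_part (mu n.+1)) = pfa_part (mu n.+1) setT /\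
  pfa_part (mu n.+1) setT =
    1 - q1 ^+ n * tv_norm (ca_part (mu 1%N)).
Proof.
have mass k : fa_measure (mu k.+1) /\ mu k.+1 setT = 1.
  elim: k => [|k [fk k1]].
    by have [[b1 p1 _] m1] := mu_init; split => //; exact: fa_measure_ba.
  rewrite mu_step//; split; first exact: fa_measure_op_A.
  by rewrite op_A_setT.
have caE k : ca_part (mu k.+1) = atomic_part (mu k.+1).
  by apply: ca_partE => //; exact: (mass k).1.
have geom k : ca_part (mu k.+1) setT = q1 ^+ k * ca_part (mu 1%N) setT.
  elim: k => [|k IH]; first by rewrite expr0 mul1r.
  have [fk k1] := mass k.
  rewrite exprS -mulrA -IH !caE mu_step//.
  by apply: (atomic_part_op_A X_discrete X_immeasurable P_kernel P_combined) => //; rewrite k1.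
have tv_ca k : tv_norm (ca_part (mu k.+1)) = ca_part (mu k.+1) setT.
  by rewrite caE tv_norm_fa_measure//; apply: fa_measure_atomic_part; exact: (mass k).1.
split; first by rewrite !tv_ca.
split; last by rewrite /pfa_part geom (mass n).2 tv_ca.
apply: tv_norm_fa_measure; rewrite /pfa_part caE.
by apply: fa_measure_sub_atomic; exact: (mass n).1.
Qed.
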